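(* Let $f\colon X\to\mathbb{R}$ be a convex function with $L$-Lipschitz continuous gradient ($L>0$), let $g=\min_{i\in I}g_i\colon X\to(-\infty,+\infty]$ be a min-convex function, let $\gamma\in(0,2/L)$, and let $T_{\rm FB}:=\operatorname{prox}_{\gamma g}\circ(\operatorname{Id}-\gamma\nabla f)$. Suppose that $x^*\in\mathbf{Fix}\,T_{\rm FB}$ and let $(\lambda_n)_{n\in\mathbb{N}}$ be a sequence in $\left(0,\frac{4-\gamma L}{2}\right]$ with $\liminf_{n\to\infty}\lambda_n\left(\frac{4-\gamma L}{2}-\lambda_n\right)>0$. Denote $r:=r(x^*;T_{\rm FB})\in(0,+\infty]$ and consider a sequence $(x_n)_{n\in\mathbb{N}}$ satisfying $$\forall n\in\mathbb{N},\quad x_{n+1}\in(1-\lambda_n)x_n+\lambda_nT_{\rm FB}(x_n)$$ with $x_0\in\operatorname{int}\mathbb{B}(x^*;r)$. Then $(x_n)_{n\in\mathbb{N}}$ converges to a point $\overline{x}\in\operatorname{Fix}T_{\rm FB}\cap\mathbb{B}(x^*;r)$. Furthermore, for sufficiently small $r$ (that is, there exists $r'\in(0,r]$ such that the following holds whenever $x_0\in\operatorname{int}\mathbb{B}(x^*;r')$), the limit point $\overline{x}$ is a local minimum of $f+g$.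
   Context: $X$ is a real finite-dimensional Hilbert space with norm $\|\cdot\|$. A function $g\colon X\to(-\infty,+\infty]$ is min-convex if $g=\min_{i\in I}g_i$ pointwise, where $I$ is a finite index set and each $g_i\colon X\to(-\infty,+\infty]$ is proper, lower semicontinuous and convex; such a representation is fixed. The Moreau envelope is ${}^{\gamma}h(x):=\inf_{y\in X}\left(h(y)+\frac{1}{2\gamma}\|x-y\|^2\right)$ and the proximity operator is $\operatorname{prox}_{\gamma h}(x):=\{y\in X:h(y)+\frac{1}{2\gamma}\|x-y\|^2={}^{\gamma}h(x)\}$. One has the representation $T_{\rm FB}(x)=\{\operatorname{prox}_{\gamma g_i}(x-\gamma\nabla f(x)):i\in\phi(x)\}$ with $\phi(x):=\{i\in I:{}^{\gamma}g(x-\gamma\nabla f(x))={}^{\gamma}g_i(x-\gamma\nabla f(x))\}$, and the radius of attraction with respect to it is $r(x^*;T_{\rm FB}):=\sup\{\delta>0:\forall x\in\mathbb{B}(x^*;\delta),\ \phi(x)\subseteq\phi(x^* )\}$, which always lies in $(0,+\infty]$. $\mathbb{B}(x;\delta)$ is the closed ball of center $x$ and radius $\delta$ (all of $X$ if $\delta=+\infty$). $\operatorname{Fix}T:=\{x:x\in T(x)\}$ and $\mathbf{Fix}\,T:=\{x:T(x)=\{x\}\}$. A local minimum of a function is a point where the function is finite and which minimizes it over some ball around the point. *)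

(* Defs.v *)
From HB Require Import structures.
From mathcomp Require Import all_boot all_order all_algebra sesquilinear.
From mathcomp Require Import boolp classical_sets reals constructive_ereal ereal.
From mathcomp Require Import topology normedtype sequences derive convex.

Set Implicit Arguments.
Unset Strict Implicit.
Unset Printing Implicit Defensive.

Import Order.TTheory GRing.Theory Num.Theory.
Import numFieldNormedType.Exports.

Local Open Scope classical_set_scope.
Local Open Scope ring_scope.

#[short(type="normedVectType")]
HB.structure Definition NormedVector (K : numDomainType) :=
  {V of NormedModule K V & Vector K V}.

(* A real finite-dimensional Hilbert space is a [normedVectType R] equipped
   with an inner product inducing its norm; completeness is automatic. *)
Definition hilbert_norm (R : realType) (X : normedVectType R)
    (dot : {dot X for idfun}) : Prop :=
  forall x : X, `|x| ^+ 2 = dot x x.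

Section MinConvex.
Context {R : realType} {X : normedVectType R}.

Definition proper_function (h : X -> \bar R) : Prop :=
  (forall x, (-oo < h x)%E) /\ exists x, (h x < +oo)%E.

(* The weights are kept in ]0, 1[, so that no product 0 * +oo occurs. *)
Definition econvex_function (h : X -> \bar R) : Prop :=
  forall (x y : X) (t : R), 0 < t -> t < 1 ->
    (h (t *: x + (1 - t) *: y)%R <= t%:E * h x + (1 - t)%:E * h y)%E.

(* [I] must be nonempty: the big operator would return +oo otherwise. *)
Definition min_convex (I : finType) (gs : I -> X -> \bar R) (g : X -> \bar R) :
    Prop :=
  [/\ (0 < #|I|)%N,
      forall i, [/\ proper_function (gs i), lower_semicontinuous (gs i)
                  & econvex_function (gs i)]
    & forall x, g x = \big[Order.min/+oo%E]_(i : I) gs i x].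

Definition moreau_envelope (gamma : R) (h : X -> \bar R) (x : X) : \bar R :=
  ereal_inf (range (fun y => (h y + ((2 * gamma)^-1 * `|x - y| ^+ 2)%:E)%E)).

Definition prox (gamma : R) (h : X -> \bar R) (x : X) : set X :=
  [set y | (h y + ((2 * gamma)^-1 * `|x - y| ^+ 2)%:E)%E
           = moreau_envelope gamma h x].

(* Set-valued operators on X are functions [X -> set X]. *)

Definition forward_backward (gamma : R) (gradf : X -> X) (g : X -> \bar R) :
    X -> set X :=
  prox gamma g \o (fun x => x - gamma *: gradf x).

Definition Fix (T : X -> set X) : set X := [set x | T x x].

Definition strongFix (T : X -> set X) : set X := [set x | T x = [set x]].

Definition active (I : finType) (gamma : R) (gradf : X -> X)
    (gs : I -> X -> \bar R) (g : X -> \bar R) (x : X) : set I :=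
  [set i | moreau_envelope gamma g (x - gamma *: gradf x)
           = moreau_envelope gamma (gs i) (x - gamma *: gradf x)].

(* Closed ball with a possibly infinite radius; the library's [closed_ball]
   only takes real radii. *)
Definition eclosed_ball (x : X) (delta : \bar R) : set X :=
  [set y | (`|x - y|%:E <= delta)%E].

Definition attraction_radius (I : finType) (phi : X -> set I) (xs : X) :
    \bar R :=
  ereal_sup [set delta | (0 < delta)%E /\
                         forall x, eclosed_ball xs delta x ->
                                   phi x `<=` phi xs].

Definition relaxed_orbit (T : X -> set X) (lambda : nat -> R) (x : nat -> X) :
    Prop :=
  forall n,
    [set (1 - lambda n) *: x n + lambda n *: y | y in T (x n)] (x n.+1).

Definition local_minimum (h : X -> \bar R) (x : X) : Prop :=
  h x \is a fin_num /\
  exists2 delta : R, 0 < delta &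
    forall y, eclosed_ball x delta%:E y -> (h x <= h y)%E.

End MinConvex.

(* Main.v *)
Require Import Defs.
From HB Require Import structures.
From mathcomp Require Import all_boot all_order all_algebra sesquilinear.
From mathcomp Require Import boolp classical_sets functions reals constructive_ereal ereal.
From mathcomp Require Import topology normedtype sequences derive convex.
From mathcomp Require Import ring lra.

Set Implicit Arguments.
Unset Strict Implicit.
Unset Printing Implicit Defensive.

Import Order.TTheory GRing.Theory Num.Theory.
Import numFieldNormedType.Exports.

Local Open Scope classical_set_scope.
Local Open Scope ring_scope.

(** Each convex piece has its own forward-backward operator
    [T_i x = prox (g_i) (x - gamma *: gradf x)], single-valued and Lipschitz.
    If [q] is a fixed point of [T_i] and [p = T_i x], firm nonexpansiveness of
    the proximity operator and cocoercivity of the gradient (Baillon-Haddad)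
    combine into
      [kappa * `|x - p| ^+ 2 <= 2 * dot (x - p) (x - q)],
      [kappa = (4 - gamma * L) / 2]
    ([fb_quasi_firm]), so that a step of relaxation [lam] in ]0, kappa] decreases
    the squared distance to [q] by at least
    [lam * (kappa - lam) * `|x - p| ^+ 2] ([relaxed_step]).

    Every element of the set-valued operator at [x] is [T_i x] for some active
    [i] ([prox_active]). As the value of the operator at [xs] is the singleton of
    [xs], all the [T_i] with [i] active at [xs] fix [xs]. Inside the ball of
    attraction only such indices are used, so the orbit is Fejer monotone with
    respect to [xs]: it stays in the ball, and its residuals tend to [0].

    Convergence then comes from the finiteness of the family, with no subsequence
    of indices to extract ([finite_family_cvg]): near a cluster point [xb], an
    operator that does not fix [xb] has a residual bounded away from [0], so
    eventually, whenever the orbit is near [xb], the operator in use fixes [xb]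
    and the next point is no farther from [xb]. The limit is a fixed point of the
    whole operator since, by continuity of the Moreau envelopes, the indices
    active near [xb] are active at [xb] ([active_near]).

    Finally every fixed point [xb] of the operator is a local minimum of [f + g]
    ([fixed_point_local_minimum]), so the radius of attraction itself serves as
    [r']: each piece [g_j] with [g_j xb = g xb] has [xb] as a proximal point, and
    the optimality conditions make [xb] a global minimum of [f + g_j]; each other
    piece stays above [g xb] near [xb] by lower semicontinuity. *)

(** * Inner product identities *)

Section Hilbert.
Context {R : realType} {X : normedVectType R}.
Variables (dot : {dot X for idfun}) (hdot : hilbert_norm dot).

Lemma dotC u v : dot u v = dot v u.
Proof. by rewrite hermC expr0 mul1r. Qed.
Lemma dotDl u v w : dot (u + v) w = dot u w + dot v w.
Proof. exact: linearDl. Qed.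
Lemma dotNl u w : dot (- u) w = - dot u w.
Proof. exact: linearNl. Qed.
Lemma dotZl a u w : dot (a *: u) w = a * dot u w.
Proof. exact: linearZl_LR. Qed.
Lemma dotDr u v w : dot w (u + v) = dot w u + dot w v.
Proof. by rewrite dotC dotDl !(dotC w). Qed.
Lemma dotNr u w : dot w (- u) = - dot w u.
Proof. by rewrite dotC dotNl (dotC w). Qed.
Lemma dotZr a u w : dot w (a *: u) = a * dot w u.
Proof. by rewrite dotC dotZl (dotC w). Qed.

Definition dotE := (dotDl, dotDr, dotNl, dotNr, dotZl, dotZr).

Lemma norm_sqrB u v : `|u - v| ^+ 2 = `|u| ^+ 2 - 2 * dot u v + `|v| ^+ 2.
Proof. by rewrite !hdot !dotE (dotC v u); ring. Qed.

(** The norm is already known to be subadditive: squaring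
    [`|u + v| <= `|u| + `|v|] and cancelling the squares gives the inequality. *)
Lemma cauchy_schwarz u v : dot u v <= `|u| * `|v|.
Proof.
have : `|u + v| ^+ 2 <= (`|u| + `|v|) ^+ 2.
  by rewrite ler_pXn2r ?nnegrE ?addr_ge0 ?ler_normD.
rewrite hdot sqrrD !hdot !dotE (dotC v u); lra.
Qed.
End Hilbert.

(** * Compactness in finite dimension *)

Section FiniteDim.
Import VectorInternalTheory.
Context {R : realType} {X : normedVectType R}.

Lemma r2v_continuous : continuous (r2v : 'rV[R]_(dim X) -> X).
Proof.
have r2vE (v : 'rV[R]_(dim X)) :
    r2v v = \sum_(i < dim X) v ord0 i *: (r2v (delta_mx 0 i) : X).
  rewrite {1}(row_sum_delta v) raddf_sum; apply: eq_bigr => i _.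
  by rewrite -[LHS]/(r2v _) linearZ_LR.
rewrite (_ : r2v = (fun v : 'rV[R]_(dim X) =>
    \sum_(i < dim X) v ord0 i *: (r2v (delta_mx 0 i) : X))); last exact/funext.
apply: (@continuous_big X _ +%R) => [|i _ v]; first exact: add_continuous.
exact: (@cvgZr_tmp _ _ _ (nbhs v) _ _ _ _ (@coord_continuous R _ _ ord0 i v)).
Qed.

(** The norm of [X] is a continuous positive function on the unit sphere of the
    coordinate space, which is compact: its minimum there is the constant. *)
Lemma v2r_bound : exists2 c : R, 0 < c &
  forall v : 'rV[R]_(dim X), c * `|v| <= `|r2v v : X|.
Proof.
pose S := [set v : 'rV[R]_(dim X) | `|v| = 1].
have [S0|/set0P S0] := eqVneq S set0.
  exists 1 => // v; have [->|v0] := eqVneq v 0; first by rewrite normr0 mulr0.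
  have : S (`|v|^-1 *: v) by rewrite /S/= normrZ normfV normr_id mulVf ?normr_eq0.
  by rewrite S0.
have cS : compact S.
  apply: bounded_closed_compact.
    by exists 1; split => // x x1 v /= ->; exact: ltW.
  apply: (@closed_comp _ _ (fun v : 'rV[R]_(dim X) => `|v|) [set 1]).
    by move=> v _; exact: norm_continuous.
  exact: closed_eq.
have [|w wS wmin] := @compact_EVT_min 'rV[R]_(dim X) R (fun v => `|r2v v : X|) S S0 cS.
  apply: continuous_subspaceT => v; apply: continuous_comp.
    exact: r2v_continuous.
  exact: norm_continuous.
exists `|r2v w : X|.
  rewrite normr_gt0; apply/eqP => w0.
  move: wS; rewrite inE /S /=; have -> : w = 0.
    by rewrite -(r2vK w) w0 linear0.
  by rewrite normr0 => /eqP; rewrite eq_sym oner_eq0.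
move=> v; have [->|v0] := eqVneq v 0; first by rewrite normr0 mulr0.
have v0' : 0 < `|v| by rewrite normr_gt0.
rewrite -ler_pdivlMr//; have := wmin (`|v|^-1 *: v).
rewrite inE /S/= normrZ normfV normr_id mulVf ?gt_eqF// => /(_ erefl).
by rewrite linearZ normrZ normfV normr_id mulrC.
Qed.

(** The ball is the image, under the continuous coordinate map, of a set that
    [v2r_bound] makes bounded. *)
Lemma compact_norm_le (M : R) : compact [set x : X | `|x| <= M].
Proof.
have [c c0 cP] := v2r_bound.
suff -> : [set x : X | `|x| <= M] = r2v @` [set v | `|r2v v : X| <= M].
  apply: continuous_compact; first exact/continuous_subspaceT/r2v_continuous.
  apply: bounded_closed_compact.
    exists (M / c); split; first by rewrite num_real.
    move=> y My v /= vM; apply/ltW/(le_lt_trans _ My).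
    by rewrite ler_pdivlMr// mulrC (le_trans (cP _)).
  apply: (@closed_comp 'rV[R]_(dim X) R (fun v => `|r2v v : X|) [set x | x <= M]).
    by move=> v _; apply: continuous_comp; [exact: r2v_continuous|exact: norm_continuous].
  exact: closed_le.
rewrite predeqE => x; split=> /=; last by case=> v vM <-.
by move=> xM; exists (v2r x); rewrite /= v2rK.
Qed.

Lemma bounded_cluster (x : nat -> X) (M : R) : (forall n, `|x n| <= M) ->
  exists xbar, forall (e : R) N, 0 < e -> exists2 n, (N <= n)%N & `|x n - xbar| < e.
Proof.
move=> xM; have [|xbar [_ xc]] := @compact_norm_le M (x @ \oo) _.
  by exists 0%N => // n _; exact: xM.
exists xbar => e N e0.
have [|_ [[n /= Nn <-] xe]] :=
    xc [set x n | n in [set n | (N <= n)%N]] _ _ (nbhsx_ballx xbar e e0).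
  by exists N => // n Nn; exists n.
exists n => //; rewrite distrC; move: xe.
by rewrite -ball_normE.
Qed.
End FiniteDim.

(** * Convex functions with Lipschitz gradient *)

Section Smooth.
Context {R : realType} {X : normedVectType R}.
Variables (dot : {dot X for idfun}) (hdot : hilbert_norm dot).
Variables (f : X -> R) (gradf : X -> X).
Hypothesis hgrad : forall x : X, is_diff x f (dot (gradf x)).

(** Convexity on the segment from [x] to [y] bounds the difference quotients at
    [x] by [f y - f x]; the directional derivative is their limit. *)
Lemma grad_ineq (hf : convex_function (setT : set X) f) x y :
  f x + dot (gradf x) (y - x) <= f y.
Proof.
have dxf : derivable f x (y - x) by apply: diff_derivable; have [] := hgrad x.
have De : 'D_(y - x) f x = dot (gradf x) (y - x).
  by rewrite deriveE; [rewrite (@diff_val _ _ _ _ _ _ _ (hgrad x))|have [] := hgrad x].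
rewrite -lerBrDl -De leNgt; apply/negP => lt.
have /cvgr_gt/(_ _ lt) /nbhs_ballP [e /= e0 he] := dxf.
pose t := Num.min (e / 2) 1 : R.
have t0 : 0 < t by rewrite lt_min divr_gt0//= ltr01.
have te : t < e by rewrite gt_min; apply/orP; left; rewrite ltr_pdivrMr// ltr_pMr// ltr1n.
have t1 : t <= 1 by rewrite ge_min lexx orbT.
have := he t; rewrite /ball/= sub0r normrN gtr0_norm// => /(_ te).
rewrite gt_eqF// => /(_ isT).
apply/negP; rewrite -leNgt.
have ti : Itv.spec (@Itv.num_sem R) (Itv.Real `[0%Z, 1%Z]) t.
  by rewrite /= /Itv.num_sem/= num_real in_itv/= t1 ltW.
have /= H : f (t *: y + (1 - t) *: x) <= t * f y + (1 - t) * f x.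
  by have := hf (Itv.mk ti) y x; rewrite !inE; exact.
have E : (t *: y + (1 - t) *: x : X) = t *: (y - x) + x.
  by rewrite scalerBr scalerBl scale1r addrA addrAC.
rewrite E in H.
rewrite [leLHS](_ : _ = t^-1 * (f (t *: (y - x) + x) - f x))//.
rewrite ler_pdivrMl// lerBlDr (le_trans H)//; lra.
Qed.

(** Along the segment, [h] is up to a constant the gap between [f] and its
    quadratic model. Its derivative is
    [dot (gradf (x + t *: v) - gradf x) v - t * L * `|v| ^+ 2],
    nonpositive by Cauchy-Schwarz and the Lipschitz condition. *)
Lemma descent (L : R) (hlip : L.-lipschitz gradf) x y :
  f y <= f x + dot (gradf x) (y - x) + L / 2 * `|y - x| ^+ 2.
Proof.
set v := y - x.
pose h (t : R) : R := f (x + t *: v) - t * dot (gradf x) v - t ^+ 2 * (L / 2 * `|v| ^+ 2).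
have dh t : is_derive t (1 : R) h (dot (gradf (x + t *: v)) v - dot (gradf x) v
    - (2 * t) * (L / 2 * `|v| ^+ 2)).
  have d1 : is_derive t (1 : R) (fun t => f (x + t *: v)) (dot (gradf (x + t *: v)) v).
    have [dd dv] := hgrad (x + t *: v).
    have dxf : derivable f (x + t *: v) v by exact: diff_derivable.
    have E : (fun s : R => s^-1 *:
        (((fun t => f (x + t *: v)) \o shift t) (s *: (1 : R)) - f (x + t *: v)))
      = (fun s : R => s^-1 *: ((f \o shift (x + t *: v)) (s *: v) - f (x + t *: v))).
      apply/funext => s /=; congr (_ *: (f _ - _)).
      by rewrite [s *: 1]mulr1 scalerDl addrCA.
    split; first by rewrite /derivable E.
    by rewrite /derive E -[lim _]/('D_v f _) deriveE// dv.
  have d2 : is_derive t (1 : R) (fun t : R => t * dot (gradf x) v) (dot (gradf x) v).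
    have H := is_deriveM (is_derive_id t (1 : R))
      (is_derive_cst (dot (gradf x) v) t (1 : R)).
    by apply: (is_derive_eq H); rewrite scaler0 add0r [_ *: _]mulr1.
  have d3 : is_derive t (1 : R) (fun t : R => t ^+ 2 * (L / 2 * `|v| ^+ 2))
      (2 * t * (L / 2 * `|v| ^+ 2)).
    have H2 := is_deriveM (is_derive_id t (1 : R)) (is_derive_id t (1 : R)).
    have H := is_deriveM H2 (is_derive_cst (L / 2 * `|v| ^+ 2) t (1 : R)).
    apply: (is_derive_eq H); rewrite scaler0 add0r /cst /GRing.scale/= mulr1; ring.
  exact: is_deriveB.
have h10 : h 1 <= h 0.
  apply: (@ler0_derive1_nincr _ h 0 1) => //.
  - move=> t; rewrite in_itv/= => /andP[t0 t1].
    rewrite derive1E (@derive_val _ _ _ _ _ _ _ (dh t)).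
    rewrite -dotNl -dotDl.
    have := hlip (x + t *: v, x) (conj I I).
    rewrite /= addrAC subrr add0r normrZ gtr0_norm// => H.
    rewrite subr_le0 (le_trans (cauchy_schwarz hdot _ _))//.
    apply: (le_trans (ler_wpM2r _ H)) => //; rewrite le_eqVlt; apply/orP; left.
    by apply/eqP; field.
  - apply: continuous_subspaceT => t; apply/differentiable_continuous/derivable1_diffP.
    by have [] := dh t.
move: h10; rewrite /h scale0r addr0 !mul0r !subr0 expr0n/= mul0r subr0 expr1n !mul1r scale1r.
by rewrite [x + v]addrC subrK !lerBlDr addrAC; lra.
Qed.

(** The Baillon-Haddad theorem. The auxiliary inequality [key] compares the
    tangent lower bound at [a] with the quadratic upper bound at [b], both at the
    minimizer [w] of their difference; adding its two symmetric instances gives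
    cocoercivity. *)
Lemma cocoercive (L : R) (L0 : 0 < L) (hf : convex_function (setT : set X) f)
    (hlip : L.-lipschitz gradf) u v :
  L^-1 * `|gradf u - gradf v| ^+ 2 <= dot (gradf u - gradf v) (u - v).
Proof.
have key a b :
    f a + dot (gradf a) (b - a) + (2 * L)^-1 * `|gradf a - gradf b| ^+ 2 <= f b.
  set d := gradf a - gradf b; pose w := b + L^-1 *: d.
  have H1 := grad_ineq hf a w.
  have H2 := descent hlip b w.
  have wb : w - b = L^-1 *: d by rewrite /w addrAC subrr add0r.
  rewrite wb normrZ exprMn normfV (gtr0_norm L0) dotZr in H2.
  have E : dot (gradf a) (w - a) = dot (gradf a) (b - a) + L^-1 * dot (gradf a) d.
    by rewrite /w [b + _ - a]addrAC !dotE.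
  rewrite E in H1.
  have D : dot (gradf a) d - dot (gradf b) d = `|d| ^+ 2 by rewrite hdot -dotNl -dotDl.
  have F : L / 2 * (L^-1 ^+ 2 * `|d| ^+ 2) = L^-1 / 2 * `|d| ^+ 2.
    by field; rewrite gt_eqF.
  have F2 : (2 * L)^-1 = L^-1 / 2 by field; rewrite gt_eqF.
  have F3 : L^-1 * dot (gradf a) d = L^-1 * `|d| ^+ 2 + L^-1 * dot (gradf b) d.
    by rewrite -D; ring.
  rewrite F in H2; rewrite F3 in H1; rewrite F2.
  lra.
have := key u v; have := key v u.
rewrite (distrC (gradf v)) invfM.
have -> : dot (gradf u - gradf v) (u - v) = - dot (gradf u) (v - u) - dot (gradf v) (u - v).
  by rewrite !dotE; ring.
lra.
Qed.
End Smooth.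

(** * Proximity operator of a convex function *)

Section Prox.
Context {R : realType} {X : normedVectType R}.
Variables (dot : {dot X for idfun}) (hdot : hilbert_norm dot).
Variables (gamma : R) (gamma0 : 0 < gamma).

Lemma prox_le (h : X -> \bar R) z p : prox gamma h z p -> forall y,
  (h p + ((2 * gamma)^-1 * `|z - p| ^+ 2)%:E <= h y + ((2 * gamma)^-1 * `|z - y| ^+ 2)%:E)%E.
Proof. by rewrite /prox/= => -> y; apply: ereal_inf_lbound; exists y. Qed.

Lemma proxP (h : X -> \bar R) z p : (forall y,
  (h p + ((2 * gamma)^-1 * `|z - p| ^+ 2)%:E <= h y + ((2 * gamma)^-1 * `|z - y| ^+ 2)%:E)%E) ->
  prox gamma h z p.
Proof.
move=> H; apply/eqP; rewrite eq_le; apply/andP; split.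
  by apply: le_ereal_inf_tmp => _ [y _ <-].
by apply: ereal_inf_lbound; exists p.
Qed.

Lemma prox_fin (h : X -> \bar R) z p : proper_function h -> prox gamma h z p ->
  h p \is a fin_num.
Proof.
move=> [hNy [y hy]] /prox_le/(_ y) H.
rewrite fin_numElt hNy/=.
have : (h p + ((2 * gamma)^-1 * `|z - p| ^+ 2)%:E < +oo)%E.
  by apply: (le_lt_trans H); rewrite lte_add_pinfty// ltry.
by case: (h p) => [r| |]; rewrite ?ltry.
Qed.

Variables (h : X -> \bar R).
Hypotheses (hp : proper_function h) (hc : econvex_function h).

(** First-order optimality: [p] is compared with the points
    [t *: y + (1 - t) *: p] of the segment to [y], where convexity bounds [h] and
    the quadratic term expands; dividing by [t] leaves an error of order [t]. *)
Lemma prox_variational z p : prox gamma h z p -> forall y,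
  (h p + (gamma^-1 * dot (z - p) (y - p))%:E <= h y)%E.
Proof.
move=> zp y; have pf := prox_fin hp zp.
case hy : (h y) => [b| |]; [|by rewrite leey|by have := hp.1 y; rewrite hy].
case ha : (h p) pf => [a| |]// _.
rewrite -EFinD lee_fin leNgt; apply/negP => lt.
set D := dot (z - p) (y - p) in lt; set N := `|y - p| ^+ 2.
have N0 : 0 <= N by rewrite exprn_ge0.
have key t : 0 < t -> t < 1 -> a + gamma^-1 * D <= b + (2 * gamma)^-1 * t * N.
  move=> t0 t1; have := prox_le zp (t *: y + (1 - t) *: p).
  have := hc y p t0 t1; rewrite hy ha -!EFinM -EFinD => H1.
  move=> H2; have := le_trans H2 (leeD2r _ H1).
  rewrite -!EFinD lee_fin.
  have -> : z - (t *: y + (1 - t) *: p) = (z - p) - t *: (y - p).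
    by rewrite scalerBl scale1r addrCA -scalerBr opprD addrA.
  have -> : `|z - p - t *: (y - p)| ^+ 2 = `|z - p| ^+ 2 - 2 * t * D + t ^+ 2 * N.
    by rewrite (norm_sqrB hdot) normrZ exprMn (gtr0_norm t0) dotZr mulrA.
  have -> : gamma^-1 = 2 * (2 * gamma)^-1 by field; rewrite gt_eqF.
  move=> H; rewrite -(ler_pM2l t0); lra.
(* [t] is chosen so small that the error term is at most half the gap [e]. *)
pose e := a + gamma^-1 * D - b.
have e0 : 0 < e by rewrite /e subr_gt0.
have g2 : 0 < (2 * gamma)^-1 by rewrite invr_gt0 mulr_gt0.
pose w := (2 * gamma)^-1 * N + 1.
have w0 : 0 < w by rewrite /w ltr_wpDl// mulr_ge0// ltW.
pose t := Num.min (e / (2 * w)) (2^-1) : R.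
have t0 : 0 < t by rewrite lt_min invr_gt0 ltr0n andbT divr_gt0// mulr_gt0.
have t1 : t < 1 by rewrite gt_min; apply/orP; right; rewrite invf_lt1// ltr1n.
have te : t * (2 * w) <= e by rewrite -ler_pdivlMr ?mulr_gt0// ge_min lexx.
have := key t t0 t1.
have : (2 * gamma)^-1 * t * N <= t * w by rewrite /w; lra.
rewrite /e in te e0 *; lra.
Qed.

(** Sum of the variational inequalities at [p] tested on [p'] and at [p'] tested
    on [p]. *)
Lemma prox_firm z p z' p' : prox gamma h z p -> prox gamma h z' p' ->
  `|p - p'| ^+ 2 <= dot (z - z') (p - p').
Proof.
move=> zp zp'; have pf := prox_fin hp zp; have pf' := prox_fin hp zp'.
have := prox_variational zp p'; have := prox_variational zp' p.
case: (h p) pf => // a _; case: (h p') pf' => // b _.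
rewrite -!EFinD !lee_fin => H1 H2.
have : gamma^-1 * (dot (z - p) (p' - p) + dot (z' - p') (p - p')) <= 0 by lra.
rewrite pmulr_rle0 ?invr_gt0// hdot !dotE; lra.
Qed.

Lemma prox_nonexp z p z' p' : prox gamma h z p -> prox gamma h z' p' ->
  `|p - p'| <= `|z - z'|.
Proof.
move=> zp zp'; have := le_trans (prox_firm zp zp') (cauchy_schwarz hdot _ _).
have [->|n0] := eqVneq p p'; first by rewrite subrr normr0.
by rewrite expr2 ler_pM2r// normr_gt0 subr_eq0.
Qed.

Lemma prox_uniq z p p' : prox gamma h z p -> prox gamma h z p' -> p = p'.
Proof.
move=> zp zp'; apply/subr0_eq/normr0_eq0/le_anti.
by rewrite normr_ge0 andbT (le_trans (prox_nonexp zp zp'))// subrr normr0.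
Qed.

Hypothesis hl : lower_semicontinuous h.

(** Lower semicontinuity at a point [x0] of the domain bounds [h] below near [x0],
    and convexity propagates the bound at a linear rate: a point [y] far from
    [x0] is seen through the point of the segment at distance [d / 2] of [x0]. *)
Lemma conic_minorant : exists x0 (A B : R), 0 < B /\
  forall y, ((A - B * `|y - x0|)%:E <= h y)%E.
Proof.
have [hNy [x0 hx0]] := hp.
case ha : (h x0) hx0 (hNy x0) => [a| |]// _ _.
have [|V /nbhs_ballP[d /= d0 dV] Vh] := hl (x := x0) (a := a - 1).
  by rewrite ha lte_fin ltrBlDr ltrDl.
have hd y : `|y - x0| < d -> ((a - 1)%:E < h y)%E.
  by move=> yd; apply/Vh/dV; rewrite -ball_normE/= distrC.
exists x0, (a - 1), (2 / d); split; first by rewrite divr_gt0.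
move=> y; set s := `|y - x0|.
have s0 : 0 <= s by rewrite normr_ge0.
have [sd|ds] := ltP s d.
  by rewrite (le_trans _ (ltW (hd _ sd)))// lee_fin gerBl mulr_ge0// divr_ge0// ltW.
have sp : 0 < s by exact: lt_le_trans ds.
case hb : (h y) (hNy y) => [b| |]// _; last by rewrite leey.
pose t := d / 2 / s.
have t0 : 0 < t by rewrite !divr_gt0.
have t1 : t < 1 by
  rewrite ltr_pdivrMr// mul1r (lt_le_trans _ ds)// gtr_pMr// invf_lt1// ltr1n.
have := hc y x0 t0 t1; rewrite ha hb -!EFinM -EFinD.
have /hd lt : `|t *: y + (1 - t) *: x0 - x0| < d.
  have -> : t *: y + (1 - t) *: x0 - x0 = t *: (y - x0).
    by rewrite scalerBl scale1r scalerBr addrA addrAC addrK.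
  by rewrite normrZ gtr0_norm// -/s /t divfK ?gt_eqF// gtr_pMr// invf_lt1// ltr1n.
move=> /(lt_le_trans lt); rewrite !lte_fin lee_fin => H.
have E : t * (2 / d * s) = 1 by rewrite /t; field; rewrite !gt_eqF.
rewrite -(ler_pM2l t0) !mulrBr E; lra.
Qed.

(** The quadratic term dominates the conic minorant, so the infimum is finite
    and minimizing sequences are bounded; a cluster point of such a sequence is a
    minimizer by lower semicontinuity. *)
Lemma prox_exists z : exists p, prox gamma h z p.
Proof.
have [hNy [x1 hx1]] := hp.
have [x0 [A [B [B0 AB]]]] := conic_minorant.
set c := (2 * gamma)^-1.
have c0 : 0 < c by rewrite invr_gt0 mulr_gt0.
pose A' := A - B * `|z - x0|.
have hA y : ((A' - B * `|z - y|)%:E <= h y)%E.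
  apply: (le_trans _ (AB y)); rewrite lee_fin /A'.
  have : `|y - x0| <= `|z - y| + `|z - x0|.
    by rewrite (distrC z y) (le_trans _ (ler_normD _ _))// addrA subrK.
  by move=> /(ler_wpM2l (ltW B0)); lra.
set m := moreau_envelope gamma h z.
have mlb y : (m <= h y + (c * `|z - y| ^+ 2)%:E)%E by apply: ereal_inf_lbound; exists y.
have mfin : m \is a fin_num.
  rewrite fin_numElt; apply/andP; split; last first.
    by apply: (le_lt_trans (mlb x1)); rewrite lte_add_pinfty// ltry.
  apply: (@lt_le_trans _ _ (A' - B ^+ 2 / (4 * c))%:E); first exact: ltNyr.
  apply: le_ereal_inf_tmp => _ [y _ <-].
  apply: (le_trans _ (leeD2r _ (hA y))); rewrite -EFinD lee_fin.
  (* Minimum over [s] of [c * s ^+ 2 - B * s], by completing the square. *)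
  have := sqr_ge0 (`|z - y| - B / (2 * c)).
  rewrite -(pmulr_rge0 _ c0).
  have -> : c * (`|z - y| - B / (2 * c)) ^+ 2 =
    c * `|z - y| ^+ 2 - B * `|z - y| + B ^+ 2 / (4 * c).
    by field; rewrite gt_eqF.
  rewrite -/c; lra.
have [y hy] : {y : nat -> X & forall n,
    (h (y n) + (c * `|z - y n| ^+ 2)%:E < m + (n.+1%:R^-1)%:E)%E}.
  apply: (@choice _ _ (fun n y =>
    (h y + (c * `|z - y| ^+ 2)%:E < m + (n.+1%:R^-1)%:E)%E)) => n.
  have [||_ [y _ <-] lt] := @lb_ereal_inf_adherent R
      (range (fun y => (h y + (c * `|z - y| ^+ 2)%:E)%E)) n.+1%:R^-1.
  - by rewrite invr_gt0.
  - exact: mfin.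
  - by exists y.
move: mfin; case mE : m => [mu| |]// _.
pose C := `|mu + 1 - A'| + B.
have yb n : `|y n| <= Num.max 1 (C / c) + `|z|.
  have zy : `|z - y n| <= Num.max 1 (C / c).
    rewrite le_max; case: (leP `|z - y n| 1) => //= s1.
    rewrite ler_pdivlMr//.
    have := le_lt_trans (leeD2r _ (hA (y n))) (hy n); rewrite mE -!EFinD lte_fin => H.
    have n1 : n.+1%:R^-1 <= 1 :> R by rewrite invf_le1 ?ler1n.
    have aux (a q s i : R) : mu + 1 - a <= q -> 0 <= q -> 1 < s -> i <= 1 ->
        a - B * s + c * s ^+ 2 < mu + i -> s * c <= q + B.
      move=> aq q0 s1' i1 lt; have s0 : 0 < s by exact: lt_trans s1'.
      have qs : q <= s * q by rewrite ler_peMl// ltW.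
      rewrite -(ler_pM2l s0); lra.
    by apply: (aux A' _ _ n.+1%:R^-1) => //; exact: ler_norm.
  rewrite (le_trans _ (lerD zy (lexx _)))//.
  by rewrite distrC (le_trans _ (ler_normD _ _))// subrK.
have [p cl] := bounded_cluster yb.
exists p; apply: proxP => w; apply: (le_trans _ (mlb w)); rewrite mE -/c.
rewrite leNgt; apply/negP => lt.
(* [q] separates the value at [p] from the infimum [mu], and [q'] is the share of
   [h] in it; both bounds persist near [p], against the minimizing sequence. *)
have [q muq qp] : exists2 q : R, mu < q & (q%:E < h p + (c * `|z - p| ^+ 2)%:E)%E.
  case: (h p + _)%E lt => [r| |]//; last by exists (mu + 1); rewrite ?ltry// ltrDl.
  rewrite lte_fin => mr; exists ((mu + r) / 2); rewrite ?lte_fin; lra.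
have [q' q'p qq'] : exists2 q' : R, (q'%:E < h p)%E & q < q' + c * `|z - p| ^+ 2.
  case: (h p) qp (hNy p) => [r| |]//; last first.
    by exists (q - c * `|z - p| ^+ 2 + 1); rewrite ?ltry// addrAC subrK ltrDl.
  rewrite -EFinD lte_fin => mr _.
  exists ((q - c * `|z - p| ^+ 2 + r) / 2); rewrite ?lte_fin; lra.
have [V /nbhs_ballP[d1 /= d10 d1V] Vh] := hl q'p.
have cont : {for p, continuous (fun y => q' + c * `|z - y| ^+ 2)}.
  apply: cvgD; first exact: cvg_cst.
  apply: cvgM; first exact: cvg_cst.
  have cn : {for p, continuous (fun y => `|z - y|)}.
    by apply: cvg_norm; apply: cvgB; [exact: cvg_cst|exact: cvg_id].
  rewrite /continuous_at expr2.
  by under [X in X @ _ --> _]eq_fun do rewrite expr2; apply: cvgM.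
have /cvgr_gt/(_ _ qq') /nbhs_ballP[d2 /= d20 d2V] := cont.
pose e := (q - mu).
have e0 : 0 < e by rewrite subr_gt0.
have /= [n Nn yp] := cl (Num.min d1 d2) (Num.bound e^-1) ltac:(by rewrite lt_min d10).
rewrite lt_min in yp; case/andP: yp => yp1 yp2.
have H1 : (q'%:E < h (y n))%E by apply/Vh/d1V; rewrite -ball_normE/= distrC.
have /= H2 : q < q' + c * `|z - y n| ^+ 2 by apply: d2V; rewrite -ball_normE/= distrC.
have := lt_trans _ (hy n) => /(_ (q' + c * `|z - y n| ^+ 2)%:E).
rewrite EFinD lteD2rE// => /(_ H1); rewrite mE -!EFinD lte_fin => H3.
have : n.+1%:R^-1 < e.
  rewrite invf_plt ?posrE// (lt_le_trans (archi_boundP _))// ?invr_ge0 ?ltW//.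
  by rewrite ltr_nat ltnS.
rewrite ltrBrDl => /(lt_trans (lt_trans H2 H3)).
by rewrite ltxx.
Qed.

End Prox.

(** * Moreau envelopes and active indices *)

Section Envelope.
Context {R : realType} {X : normedVectType R}.
Variables (dot : {dot X for idfun}) (hdot : hilbert_norm dot).
Variables (gamma : R) (gamma0 : 0 < gamma).

Let c0 : 0 < (2 * gamma)^-1. Proof. by rewrite invr_gt0 mulr_gt0. Qed.

Lemma moreau_fin (h : X -> \bar R) z p : proper_function h -> prox gamma h z p ->
  moreau_envelope gamma h z \is a fin_num.
Proof. by move=> hp zp; rewrite -[moreau_envelope _ _ _]zp fin_numD (prox_fin hp zp). Qed.

(** The proximal point [p] of [z] is a competitor in the infimum at [z']. *)
Lemma moreau_le (h : X -> \bar R) z z' p : prox gamma h z p ->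
  (moreau_envelope gamma h z' <= moreau_envelope gamma h z
   + ((2 * gamma)^-1 * (`|z' - z| * (2 * `|z - p| + `|z' - z|)))%:E)%E.
Proof.
move=> zp; rewrite -[moreau_envelope _ _ z]zp.
apply: (@le_trans _ _ (h p + ((2 * gamma)^-1 * `|z' - p| ^+ 2)%:E)%E).
  by apply: ereal_inf_lbound; exists p.
rewrite -addeA leeD2l// -EFinD lee_fin -mulrDr ler_pM2l//.
have H : `|z' - p| <= `|z' - z| + `|z - p|.
  by rewrite (le_trans _ (ler_normD _ _))// addrA subrK.
have := lerXn2r 2 _ _ H; rewrite !nnegrE.
move=> /(_ (normr_ge0 _) (addr_ge0 (normr_ge0 _) (normr_ge0 _))) H2.
by rewrite (le_trans H2)// le_eqVlt; apply/orP; left; apply/eqP; ring.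
Qed.

(** Continuity of the envelope, in a form that stays in the extended reals. Both
    bounds are instances of [moreau_le]; in the second one the proximal point
    moves with [z'], and its nonexpansiveness keeps the modulus uniform. *)
Lemma moreau_near (h : X -> \bar R) (hp : proper_function h)
    (hl : lower_semicontinuous h) (hc : econvex_function h) z (e : R) : 0 < e ->
  \forall z' \near z,
    (moreau_envelope gamma h z' <= moreau_envelope gamma h z + e%:E)%E /\
    (moreau_envelope gamma h z <= moreau_envelope gamma h z' + e%:E)%E.
Proof.
move=> e0; have [p zp] := prox_exists gamma0 hp hc hl z.
pose M := (2 * gamma)^-1 * (2 * `|z - p| + 5).
have M0 : 0 < M by rewrite mulr_gt0// ltr_wpDl// mulr_ge0.
apply/nbhs_ballP; exists (Num.min 1 (e / M)) => /=; first by rewrite lt_min ltr01 divr_gt0.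
move=> z'; rewrite -ball_normE/= lt_min ltr_pdivlMr// => /andP[s1 sM].
have key t : t <= 2 * `|z - p| + 5 -> (2 * gamma)^-1 * (`|z - z'| * t) <= e.
  by move=> tM; rewrite (le_trans _ (ltW sM))// mulrCA ler_wpM2l// ler_pM2l.
split.
  apply: (le_trans (moreau_le z' zp)); rewrite leeD2l// lee_fin (distrC z') key//.
  by rewrite lerD2l (le_trans (ltW s1))// ler1n.
have [p' zp'] := prox_exists gamma0 hp hc hl z'.
apply: (le_trans (moreau_le z zp')); rewrite leeD2l// lee_fin key//.
have pp := prox_nonexp hdot gamma0 hp hc zp zp'.
have : `|z' - p'| <= `|z - z'| + `|z - p| + `|p - p'|.
  rewrite (distrC z z') (le_trans _ (lerD (ler_normD _ _) (lexx _)))//.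
  by rewrite (le_trans _ (ler_normD _ _))// !addrA !subrK.
lra.
Qed.

Section Active.
Variables (I : finType) (gs : I -> X -> \bar R) (g : X -> \bar R).
Hypothesis hg : min_convex gs g.

Lemma min_convex_le i y : (g y <= gs i y)%E.
Proof. by have [_ _ ->] := hg; exact: bigmin_le. Qed.

Lemma min_convex_attained y : exists i, g y = gs i y.
Proof.
have [/card_gt0P[i0 _] _ ->] := hg.
by exists [arg min_(i < i0) gs i y]%O; apply: bigmin_eq_arg => // i _; rewrite leey.
Qed.

Lemma min_convex_proper : proper_function g.
Proof.
have [/card_gt0P[i0 _] H _] := hg; split => [x|].
  by have [i ->] := min_convex_attained x; have [[+ _] _ _] := H i; exact.
have [[_ [x xi]] _ _] := H i0; exists x.
exact: le_lt_trans (min_convex_le i0 x) xi.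
Qed.

Lemma moreau_min_le i z : (moreau_envelope gamma g z <= moreau_envelope gamma (gs i) z)%E.
Proof.
apply: le_ereal_inf_tmp => _ [y _ <-].
apply: (@le_trans _ _ (g y + ((2 * gamma)^-1 * `|z - y| ^+ 2)%:E)%E).
  by apply: ereal_inf_lbound; exists y.
by rewrite leeD2r// min_convex_le.
Qed.

Lemma moreau_min_ge z e : (forall i, (e <= moreau_envelope gamma (gs i) z)%E) ->
  (e <= moreau_envelope gamma g z)%E.
Proof.
move=> H; apply: le_ereal_inf_tmp => _ [y _ <-].
have [i ->] := min_convex_attained y; apply: (le_trans (H i)).
by apply: ereal_inf_lbound; exists y.
Qed.

Lemma active_prox i z p :
  moreau_envelope gamma g z = moreau_envelope gamma (gs i) z ->
  prox gamma (gs i) z p -> prox gamma g z p.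
Proof.
move=> E zp; apply: proxP => y.
apply: (@le_trans _ _ (moreau_envelope gamma g z)).
  by rewrite E -[moreau_envelope _ _ _]zp leeD2r// min_convex_le.
by apply: ereal_inf_lbound; exists y.
Qed.

Lemma prox_active j z p : prox gamma g z p -> g p = gs j p ->
  prox gamma (gs j) z p /\ moreau_envelope gamma g z = moreau_envelope gamma (gs j) z.
Proof.
move=> zp gp; have zp' : prox gamma (gs j) z p.
  apply: proxP => y; rewrite -gp; apply: (le_trans (prox_le zp y)).
  by rewrite leeD2r// min_convex_le.
by split => //; rewrite -[LHS]zp -[RHS]zp' gp.
Qed.

(** Outer semicontinuity of the active set: an index inactive at [z] is strictly
    beaten there by another one, and still is near [z] by continuity of the two
    envelopes. *)
Lemma active_near z : \forall z' \near z, forall i,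
  moreau_envelope gamma g z' = moreau_envelope gamma (gs i) z' ->
  moreau_envelope gamma g z = moreau_envelope gamma (gs i) z.
Proof.
have [_ H _] := hg.
apply: filter_forall => i.
have [Ei|Ei] := pselect (moreau_envelope gamma g z = moreau_envelope gamma (gs i) z).
  exact: nearW.
have [j jlt] : exists j, (moreau_envelope gamma (gs j) z < moreau_envelope gamma (gs i) z)%E.
  apply/not_existsP => Hj; apply: Ei; apply/le_anti; rewrite moreau_min_le/=.
  by apply: moreau_min_ge => j; rewrite leNgt; apply/negP/Hj.
have [hpi hli hci] := H i; have [hpj hlj hcj] := H j.
have [pi zpi] := prox_exists gamma0 hpi hci hli z.
have [pj zpj] := prox_exists gamma0 hpj hcj hlj z.
have fi := moreau_fin hpi zpi; have fj := moreau_fin hpj zpj.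
pose a := fine (moreau_envelope gamma (gs j) z).
pose b := fine (moreau_envelope gamma (gs i) z).
have ab : a < b by rewrite -lte_fin !fineK.
have e0 : 0 < (b - a) / 3 by rewrite divr_gt0// subr_gt0.
have Mi := moreau_near hpi hli hci z e0; have Mj := moreau_near hpj hlj hcj z e0.
apply: filterS2 Mi Mj => z' [_ A] [B _] E; exfalso.
have := moreau_min_le j z'; rewrite E => /le_trans/(_ B) {}B.
have := le_trans A (leeD2r _ B).
rewrite -(fineK fi) -(fineK fj) -!EFinD lee_fin -/a -/b; lra.
Qed.

End Active.
End Envelope.

(** * Convergence of quasi-Fejer iterations over a finite family *)

Section Cvg.
Context {R : realType} {X : normedVectType R}.

(** Near a cluster point [xb], the operators that move [xb] have residuals larger
    than those of the sequence, so they are not used there. Hence the sequence,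
    once it is late and near [xb], can only get closer to it. *)
Lemma finite_family_cvg (I : finType) (F : I -> X -> X) (x : nat -> X)
    (i : nat -> I) (M : R) :
  (forall j, continuous (F j)) -> (forall n, `|x n| <= M) ->
  (fun n => `|x n - F (i n) (x n)|) @ \oo --> (0 : R) ->
  (forall n q, F (i n) q = q -> `|x n.+1 - q| <= `|x n - q|) ->
  exists2 xb, x @ \oo --> xb & \forall n \near \oo, F (i n) xb = xb.
Proof.
move=> Fc xM res step; have [xb cl] := bounded_cluster xM.
have A : \forall y \near xb, forall j, F j xb != xb -> `|xb - F j xb| / 2 < `|y - F j y|.
  apply: filter_forall => j; have [->|Fj] := eqVneq (F j xb) xb; first exact: nearW.
  have lt : `|xb - F j xb| / 2 < `|xb - F j xb|.
    by rewrite ltr_pdivrMr// ltr_pMr ?ltr1n// normr_gt0 subr_eq0 eq_sym.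
  have cn : {for xb, continuous (fun y => `|y - F j y|)}.
    by apply: cvg_norm; apply: cvgB; [exact: cvg_id|exact: Fc].
  by near=> y => _; near: y; exact: (cvgr_gt _ cn _ lt).
have B : \forall n \near \oo, forall j, F j xb != xb ->
    `|x n - F (i n) (x n)| < `|xb - F j xb| / 2.
  apply: filter_forall => j; have [->|Fj] := eqVneq (F j xb) xb; first exact: nearW.
  near=> n => _; near: n; apply: (cvgr_lt _ res).
  by rewrite divr_gt0// normr_gt0 subr_eq0 eq_sym.
have [d /= d0 dA] := (nbhs_ballP _ _).1 A.
have [N _ NB] := B.
have fixed n : (N <= n)%N -> `|x n - xb| < d -> F (i n) xb = xb.
  move=> Nn xd; apply/eqP/negPn/negP => ne.
  have := dA (x n); rewrite -ball_normE/= distrC => /(_ xd _ ne).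
  by move=> /(lt_trans (NB n Nn _ ne)); rewrite ltxx.
have mono e n0 : e <= d -> (N <= n0)%N -> `|x n0 - xb| < e ->
    forall n, (n0 <= n)%N -> `|x n - xb| < e.
  move=> ed Nn0 xe; elim=> [|n IH]; first by rewrite leqn0 => /eqP n00; rewrite -n00.
  rewrite leq_eqVlt => /predU1P[<-//|]; rewrite ltnS => n0n.
  apply: (le_lt_trans (step _ _ _) (IH n0n)).
  by apply: fixed; [exact: leq_trans n0n|exact: lt_le_trans (IH n0n) ed].
exists xb.
  apply/cvgrPdist_lt => e e0.
  have [|n0 Nn0 xe] := cl (Num.min e d) N; first by rewrite lt_min e0.
  exists n0 => // n /= n0n; rewrite distrC.
  apply: (@lt_le_trans _ _ (Num.min e d)); last by rewrite ge_min lexx.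
  by apply: (mono _ n0) => //; rewrite ge_min lexx orbT.
have [n0 Nn0 xe] := cl d N d0.
exists n0 => // n /= n0n; apply: fixed; first exact: leq_trans n0n.
exact: (mono _ n0).
Unshelve. all: by end_near. Qed.

(** Eventually [w] is at least some [e > 0], hence [rho n ^+ 2] is at most the
    decrease of the convergent sequence [d n ^+ 2] divided by [e]. *)
Lemma residual_cvg0 (d rho w : nat -> R) :
  (forall n, 0 <= d n) -> (forall n, 0 <= rho n) ->
  (forall n, 0 <= w n) -> (forall n, d n.+1 ^+ 2 <= d n ^+ 2 - w n * rho n ^+ 2) ->
  (0 < limn_einf (fun n => (w n)%:E))%E -> rho @ \oo --> 0.
Proof.
move=> d0 rho0 w0 step; rewrite limn_einf_lim.
rewrite (cvg_lim _ (cvg_einfs_sup (u := _)))// => /ereal_sup_gt [_ [N _ <-] Npos].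
have [e e0 ew] : exists2 e, 0 < e & forall n, (N <= n)%N -> e <= w n.
  have ub n : (N <= n)%N -> (einfs (fun n => (w n)%:E) N <= (w n)%:E)%E.
    by move=> Nn; apply: ereal_inf_lbound; exists n.
  have ff : einfs (fun n => (w n)%:E) N \is a fin_num.
    by rewrite fin_numElt (lt_trans _ Npos)//= (le_lt_trans (ub N _))// ltry.
  exists (fine (einfs (fun n => (w n)%:E) N)); first by rewrite -lte_fin fineK.
  by move=> n /ub; rewrite -{1}(fineK ff) lee_fin.
have cd : cvgn (fun n => d n ^+ 2).
  apply: nonincreasing_is_cvgn.
    apply/nonincreasing_seqP => n; rewrite (le_trans (step n))// gerBl.
    by rewrite mulr_ge0// sqr_ge0.
  by exists 0 => _ [n _ <-]; exact: sqr_ge0.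
have cdiff : (fun n => (d n ^+ 2 - d n.+1 ^+ 2) / e) @ \oo --> 0.
  have -> : 0 = (limn (fun n => d n ^+ 2) - limn (fun n => d n ^+ 2)) / e.
    by rewrite subrr mul0r.
  apply: cvgMr_tmp; apply: cvgB => //.
  have := cd; rewrite -(cvg_shiftS (fun n => d n ^+ 2)) => H; exact: H.
apply/cvgr0Pnorm_lt => t t0.
have t20 : 0 < t ^+ 2 by rewrite exprn_gt0.
near=> n.
have Nn : (N <= n)%N by near: n; exact: nbhs_infty_ge.
have H : (d n ^+ 2 - d n.+1 ^+ 2) / e < t ^+ 2 by near: n; exact: (cvgr_lt _ cdiff).
rewrite ger0_norm// -(@ltr_pXn2r _ 2) ?nnegrE ?(ltW t0)//.
apply: le_lt_trans H; rewrite ler_pdivlMr// mulrC.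
have : e * rho n ^+ 2 <= w n * rho n ^+ 2 by rewrite ler_wpM2r ?sqr_ge0// ew.
have := step n; lra.
Unshelve. all: by end_near. Qed.

End Cvg.

(** * Forward-backward step of one convex piece *)

Section ForwardBackward.
Context {R : realType} {X : normedVectType R}.
Variables (dot : {dot X for idfun}) (hdot : hilbert_norm dot).
Variables (f : X -> R) (gradf : X -> X) (L : R).
Hypotheses (hL : 0 < L) (hf : convex_function (setT : set X) f).
Hypothesis hgrad : forall x : X, is_diff x f (dot (gradf x)).
Hypothesis hlip : L.-lipschitz gradf.
Variables (gamma : R) (gamma0 : 0 < gamma).

Lemma forward_continuous : continuous (fun x => x - gamma *: gradf x).
Proof.
move=> x; apply: cvgB; first exact: cvg_id.
apply: cvgZl_tmp; apply/cvgrPdist_lt => e e0.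
apply/nbhs_ballP; exists (e / L) => /=; first by rewrite divr_gt0.
move=> y; rewrite -ball_normE/= ltr_pdivlMr// mulrC; apply: le_lt_trans.
exact: (@hlip (x, y) (conj I I)).
Qed.

(** With [u = x - p], [w = x - q] and [d = gradf x - gradf q], firmness gives
    [dot u w >= `|u| ^+ 2 + gamma * dot d w - gamma * dot d u], and cocoercivity
    bounds [dot d w] below by [`|d| ^+ 2 / L]. Completing the square in [d] costs
    [gamma * L / 4 * `|u| ^+ 2]. *)
Lemma fb_quasi_firm (h : X -> \bar R) x p q :
  proper_function h -> econvex_function h ->
  prox gamma h (x - gamma *: gradf x) p -> prox gamma h (q - gamma *: gradf q) q ->
  (4 - gamma * L) / 2 * `|x - p| ^+ 2 <= 2 * dot (x - p) (x - q).
Proof.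
move=> hp hc xp qq; have firm := prox_firm hdot gamma0 hp hc xp qq.
have coco := cocoercive hdot hgrad hL hf hlip x q.
set d := gradf x - gradf q in coco.
set u := x - p; set w := x - q in coco *.
have Epq : p - q = w - u by rewrite /w /u opprB [RHS]addrC addrA subrK.
have Ez : x - gamma *: gradf x - (q - gamma *: gradf q) = w - gamma *: d.
  by rewrite /w /d scalerBr !opprD addrACA.
rewrite Ez Epq (norm_sqrB hdot) in firm.
have sq := sqr_ge0 (`|d - (L / 2) *: u|).
have L2 : 0 <= L / 2 by rewrite divr_ge0 ?ltW.
rewrite (norm_sqrB hdot) normrZ exprMn (ger0_norm L2) dotZr in sq.
have H1 : 0 <= gamma / L * (`|d| ^+ 2 - 2 * (L / 2 * dot d u) + (L / 2) ^+ 2 * `|u| ^+ 2).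
  by rewrite mulr_ge0// divr_ge0// ltW.
have E1 : gamma / L * (`|d| ^+ 2 - 2 * (L / 2 * dot d u) + (L / 2) ^+ 2 * `|u| ^+ 2) =
    gamma * (L^-1 * `|d| ^+ 2) - gamma * dot d u + gamma * L / 4 * `|u| ^+ 2.
  by field; rewrite gt_eqF.
rewrite E1 in H1; have H2 := ler_wpM2l (ltW gamma0) coco.
clearbody u w d; rewrite !dotE (dotC dot w u) -!hdot in firm; lra.
Qed.

Lemma relaxed_step (x p q : X) (kappa lam : R) : 0 <= lam ->
  kappa * `|x - p| ^+ 2 <= 2 * dot (x - p) (x - q) ->
  `|(1 - lam) *: x + lam *: p - q| ^+ 2 <=
    `|x - q| ^+ 2 - lam * (kappa - lam) * `|x - p| ^+ 2.
Proof.
move=> l0 H.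
have -> : (1 - lam) *: x + lam *: p - q = (x - q) - lam *: (x - p).
  by rewrite scalerBl scale1r scalerBr opprD opprK -[LHS]addrA [lam *: p - q]addrC addrACA.
rewrite (norm_sqrB hdot) normrZ exprMn ger0_norm// dotZr (dotC dot (x - q)).
have := ler_wpM2l l0 H; lra.
Qed.

End ForwardBackward.

(** * Radius of attraction *)

Section Radius.
Context {R : realType} {X : normedVectType R}.
Variables (I : finType) (phi : X -> set I) (xs : X).

Lemma attraction_radius_gt0 : (\forall x \near xs, phi x `<=` phi xs) ->
  (0 < attraction_radius phi xs)%E.
Proof.
move=> /nbhs_ballP[e /= e0 he]; apply: (@lt_le_trans _ _ (e / 2)%:E).
  by rewrite lte_fin divr_gt0.
apply: ereal_sup_ubound; split; first by rewrite lte_fin divr_gt0.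
move=> x; rewrite /eclosed_ball/= lee_fin => xe; apply: he; rewrite -ball_normE/=.
by rewrite (le_lt_trans xe)// ltr_pdivrMr// ltr_pMr// ltr1n.
Qed.

Lemma attraction_radius_sub x : (`|xs - x|%:E < attraction_radius phi xs)%E ->
  phi x `<=` phi xs.
Proof.
by move=> /ereal_sup_gt[d [d0 hd] xd]; apply: hd; rewrite /eclosed_ball/= ltW.
Qed.

(** An interior point can be pushed slightly away from the centre without leaving
    the closed ball. *)
Lemma interior_eclosed_ball (r : \bar R) x : (0 < r)%E -> (eclosed_ball xs r)^° x ->
  (`|xs - x|%:E < r)%E.
Proof.
move=> r0 /nbhs_ballP[e /= e0 he].
have [->|xx] := eqVneq xs x; first by rewrite subrr normr0.
have n0 : 0 < `|xs - x| by rewrite normr_gt0 subr_eq0.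
pose t := e / 2 / `|xs - x|.
have t0 : 0 < t by rewrite !divr_gt0.
have : eclosed_ball xs r (x + t *: (x - xs)).
  apply: he; rewrite -ball_normE/= opprD addrA subrr sub0r normrN normrZ gtr0_norm//.
  by rewrite (distrC x) /t divfK ?gt_eqF// ltr_pdivrMr// ltr_pMr// ltr1n.
rewrite /eclosed_ball/=; apply: lt_le_trans.
have -> : xs - (x + t *: (x - xs)) = (1 + t) *: (xs - x).
  by rewrite scalerDl scale1r opprD addrA -scalerN opprB.
by rewrite lte_fin normrZ gtr0_norm ?addr_gt0// ltr_pMl// ltrDl.
Qed.

End Radius.

(** * Fixed points are local minima *)

Section LocalMin.
Context {R : realType} {X : normedVectType R}.
Variables (dot : {dot X for idfun}) (hdot : hilbert_norm dot).
Variables (f : X -> R) (gradf : X -> X).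
Hypotheses (hf : convex_function (setT : set X) f).
Hypothesis hgrad : forall x : X, is_diff x f (dot (gradf x)).
Variables (gamma : R) (gamma0 : 0 < gamma).
Variables (I : finType) (gs : I -> X -> \bar R) (g : X -> \bar R).
Hypothesis hg : min_convex gs g.

(** For a piece [gs j] that attains [g xb], the variational inequality of its
    proximal point reads [gs j y >= g xb - dot (gradf xb) (y - xb)], which the
    gradient inequality of [f] compensates. The other pieces exceed [g xb] by a
    margin near [xb], larger than the variation of [f]. *)
Lemma fixed_point_local_minimum xb : Fix (forward_backward gamma gradf g) xb ->
  local_minimum (fun y => ((f y)%:E + g y)%E) xb.
Proof.
move=> fx; have {fx} zp : prox gamma g (xb - gamma *: gradf xb) xb := fx.
have [_ H _] := hg.
have gf := prox_fin (min_convex_proper hg) zp.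
case ga : (g xb) gf => [a| |]// _.
split; first by rewrite ga.
rewrite ga.
have : \forall y \near xb, forall j, ((f xb)%:E + a%:E <= (f y)%:E + gs j y)%E.
  apply: filter_forall => j; have [hp hl hc] := H j.
  have := min_convex_le hg j xb; rewrite ga le_eqVlt => /predU1P[gj|lt].
    rewrite -ga in gj; have [zpj _] := prox_active hg zp gj.
    apply: nearW => y; have := prox_variational hdot gamma0 hp hc zpj y.
    rewrite -gj ga addrAC subrr sub0r dotNl dotZl mulrN mulKf ?gt_eqF// => Hv.
    apply: (le_trans _ (leeD2l _ Hv)); rewrite -!EFinD lee_fin.
    have := grad_ineq hgrad hf xb y; lra.
  have [b ab bj] : exists2 b : R, a < b & (b%:E < gs j xb)%E.
    case: (gs j xb) lt => [r| |]//; last by exists (a + 1); rewrite ?ltry// ltrDl.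
    rewrite lte_fin => ar; exists ((a + r) / 2); rewrite ?lte_fin; lra.
  have [V Vn Vh] := hl _ _ bj.
  have fc : {for xb, continuous f} by apply: differentiable_continuous; have [] := hgrad xb.
  have lt2 : f xb - (b - a) < f xb by rewrite ltrBlDr ltrDl subr_gt0.
  have Fn : \forall y \near xb, f xb - (b - a) < f y by exact: (cvgr_gt _ fc _ lt2).
  apply: filterS2 Vn Fn => y /Vh gb fy.
  apply: (le_trans _ (leeD2l _ (ltW gb))); rewrite -!EFinD lee_fin; lra.
move=> /nbhs_ballP[e /= e0 he]; exists (e / 2); first by rewrite divr_gt0.
move=> y; rewrite /eclosed_ball/= lee_fin => ye.
have [j ->] := min_convex_attained hg y; apply: he; rewrite -ball_normE/=.
by rewrite (le_lt_trans ye)// ltr_pdivrMr// ltr_pMr// ltr1n.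
Qed.
End LocalMin.

(** * Convergence of the relaxed forward-backward algorithm *)

Theorem theorem6p4 (R : realType) (X : normedVectType R)
    (dot : {dot X for idfun}) (hdot : hilbert_norm dot)
    (f : X -> R) (gradf : X -> X) (L : R)
    (hL : 0 < L)
    (hf : convex_function (setT : set X) f)
    (hgrad : forall x : X, is_diff x f (dot (gradf x)))
    (hlip : L.-lipschitz gradf)
    (I : finType) (gs : I -> X -> \bar R) (g : X -> \bar R)
    (hg : min_convex gs g)
    (gamma : R) (hgamma0 : 0 < gamma) (hgamma : gamma < 2 / L)
    (xs : X) (hxs : strongFix (forward_backward gamma gradf g) xs)
    (lambda : nat -> R)
    (hlambda : forall n, 0 < lambda n <= (4 - gamma * L) / 2)
    (hliminf : (0 < limn_einf (fun n =>
       (lambda n * ((4 - gamma * L) / 2 - lambda n))%:E))%E) :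
  let T := forward_backward gamma gradf g in
  let r := attraction_radius (active gamma gradf gs g) xs in
  (forall x : nat -> X, relaxed_orbit T lambda x ->
     (eclosed_ball xs r)^° (x 0%N) ->
     exists2 xbar : X, x @ \oo --> xbar & (Fix T `&` eclosed_ball xs r) xbar) /\
  (exists r' : \bar R, [/\ (0 < r')%E, (r' <= r)%E &
     forall (x : nat -> X) (xbar : X), relaxed_orbit T lambda x ->
       (eclosed_ball xs r')^° (x 0%N) ->
       x @ \oo --> xbar ->
       local_minimum (fun y => ((f y)%:E + g y)%E) xbar]).
Proof.
move=> T r; set S := fun x : X => x - gamma *: gradf x.
have [_ H _] := hg.
have Sc : continuous S by exact: (forward_continuous hL hlip).
have near_active x : \forall y \near x,
    active gamma gradf gs g y `<=` active gamma gradf gs g x.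
  have HN : nbhs x (S @^-1` _) := Sc x _ (active_near hdot hgamma0 hg (S x)).
  by apply: filterS HN => y Hy i; exact: Hy.
have r0 : (0 < r)%E by exact: attraction_radius_gt0.
(* Only the convergence matters, as all fixed points are local minima. *)
suff main : forall x : nat -> X, relaxed_orbit T lambda x ->
     (eclosed_ball xs r)^° (x 0%N) ->
     exists2 xbar : X, x @ \oo --> xbar & (Fix T `&` eclosed_ball xs r) xbar.
  split => //; exists r; split => // x xbar orb x0 cx.
  have [y cy [fy _]] := main x orb x0.
  have -> : xbar = y by apply: (cvg_unique _ cx cy).
  exact: (fixed_point_local_minimum hdot hf hgrad hgamma0 hg fy).
move=> x orb /(interior_eclosed_ball r0) x0r.
have [P PP] : {P : I -> X -> X & forall i z, prox gamma (gs i) z (P i z)}.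
  have ex i : {Pi : X -> X & forall z, prox gamma (gs i) z (Pi z)}.
    apply: choice => z; have [hp hl hc] := H i; exact: (prox_exists hgamma0 hp hc hl).
  by exists (fun i => projT1 (ex i)) => i; exact: (projT2 (ex i)).
pose F i y := P i (S y).
have [i iP] : {i : nat -> I & forall n, active gamma gradf gs g (x n) (i n) /\
    x n.+1 = (1 - lambda n) *: x n + lambda n *: F (i n) (x n)}.
  apply: (@choice _ _ (fun n j => active gamma gradf gs g (x n) j /\
    x n.+1 = (1 - lambda n) *: x n + lambda n *: F j (x n))) => n.
  have [p Tp <-] := orb n.
  have [j gj] := min_convex_attained hg p.
  have [pj aj] := prox_active hg Tp gj; exists j; split => //.
  by have [hp hl hc] := H j; rewrite (prox_uniq hdot hgamma0 hp hc pj (PP j (S (x n)))).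
have Fc j : continuous (F j).
  move=> y; apply: continuous_comp; first exact: Sc.
  apply/cvgrPdist_lt => e e0; apply/nbhs_ballP; exists e => // z.
  rewrite -ball_normE/=; apply: le_lt_trans.
  by have [hp hl hc] := H j; exact: (prox_nonexp hdot hgamma0 hp hc).
set kappa := (4 - gamma * L) / 2 in hlambda hliminf.
have w0 n : 0 <= lambda n * (kappa - lambda n).
  by have /andP[l0 lk] := hlambda n; rewrite mulr_ge0 ?subr_ge0// ltW.
have step n q : F (i n) q = q ->
    `|x n.+1 - q| ^+ 2 <= `|x n - q| ^+ 2
      - lambda n * (kappa - lambda n) * `|x n - F (i n) (x n)| ^+ 2.
  move=> Fq; have [hp hl hc] := H (i n); have [_ ->] := iP n.
  have /andP[l0 _] := hlambda n; apply: (relaxed_step hdot (ltW l0)).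
  apply: (fb_quasi_firm hdot hL hf hgrad hlip hgamma0 hp hc); first exact: PP.
  by rewrite -[X in prox _ _ _ X]Fq; exact: PP.
have mono n q : F (i n) q = q -> `|x n.+1 - q| <= `|x n - q|.
  move=> /step H1; rewrite -(@ler_pXn2r _ 2) ?nnegrE//.
  by rewrite (le_trans H1)// gerBl mulr_ge0// sqr_ge0.
have Fxs j : active gamma gradf gs g xs j -> F j xs = xs.
  move=> aj; have : T xs (F j xs) by exact: (active_prox hg aj (PP _ _)).
  by rewrite [T xs]hxs.
have Fin n : `|x n - xs| <= `|x 0%N - xs| -> F (i n) xs = xs.
  move=> xn; apply: Fxs; apply: attraction_radius_sub (proj1 (iP n)).
  by apply: le_lt_trans x0r; rewrite lee_fin distrC (distrC xs).
have ball n : `|x n - xs| <= `|x 0%N - xs|.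
  by elim: n => // n IH; apply: (le_trans _ IH); apply/mono/Fin.
have res : (fun n => `|x n - F (i n) (x n)|) @ \oo --> (0 : R).
  apply: (@residual_cvg0 R (fun n => `|x n - xs|) _ _ _ _ w0) => // n.
  exact/step/Fin.
have bd n : `|x n| <= `|x 0%N - xs| + `|xs|.
  by rewrite (le_trans _ (lerD (ball n) (lexx _)))// (le_trans _ (ler_normD _ _))// subrK.
have [xb cx Fxb] := finite_family_cvg Fc bd res mono.
exists xb => //; split.
  have /filter_ex[n [Fn an]] : \forall n \near \oo, F (i n) xb = xb /\
      active gamma gradf gs g (x n) `<=` active gamma gradf gs g xb.
    by near=> n; split; near: n => //; exact: (cx _ (near_active xb)).
  have aj := an _ (proj1 (iP n)).
  have := active_prox hg aj (PP (i n) (S xb)).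
  by rewrite -/(F _ _) Fn.
rewrite /eclosed_ball/=; apply: (@le_trans _ _ (`|xs - x 0%N|%:E)); last exact: ltW.
rewrite lee_fin.
have cn : (fun n => `|x n - xs|) @ \oo --> `|xb - xs|.
  by apply: cvg_norm; apply: cvgB => //; exact: cvg_cst.
rewrite distrC (distrC xs) -(cvg_lim _ cn)//.
apply: limr_le; first by apply/cvg_ex; exists `|xb - xs|.
exact: nearW.
Unshelve. all: by end_near. Qed.
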